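(* Let $L>0$, $n\in\mathbb{N}$, $d\in\mathbb{N}$, let $f:\mathbb{R}^d\to\mathbb{R}$ be a convex $L$-$\mathrm{QG}^+$ function, and let $x_0\in\mathbb{R}^d$. Let $x_n$ be the output, after $n$ iterations started at $x_0$, of either the heavy-ball method for $\mathrm{QG}^+$ convex functions (run with parameter $L$) or the heavy-ball method with line-search (both described in the context). Then $$f(x_n)-f_\star\le\frac L2\,\frac1{n+1}\,d(x_0,\mathcal{X}_\star)^2 .$$
   Context: All functions $f:\mathbb{R}^d\to\mathbb{R}$ considered are assumed to have a non-empty set of global minimizers $\mathcal{X}_\star$; $f_\star=\min_{x} f(x)$; $d(x,\mathcal{X}_\star)=\min_{x_\star\in\mathcal{X}_\star}\|x-x_\star\|_2$. The function $f$ is $L$-quadratically upper bounded ($L$-$\mathrm{QG}^+$) if $f(x)-f_\star\le\frac L2 d(x,\mathcal{X}_\star)^2$ for all $x$. $\partial f(x)$ is the convex subdifferential. Heavy-ball method for $\mathrm{QG}^+$ convex functions (input $x_0$, $L$): for $k=1,\dots,n$, pick $g_{k-1}\in\partial f(x_{k-1})$ and set $$x_k=\frac{k}{k+1}x_{k-1}+\frac1{k+1}x_0-\frac1{k+1}\sum_{i=0}^{k-1}\frac1L g_i .$$ Heavy-ball method with line-search (input $x_0$; $v_0=0$): for $k=1,\dots,n$, set $y_k=\frac{k}{k+1}x_{k-1}+\frac1{k+1}x_0$; pick $g_{k-1}\in\partial f(x_{k-1})$ such that $\langle g_{k-1},v_{k-1}\rangle=0$; set $v_k=v_{k-1}+g_{k-1}$;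 choose $\alpha_k\in\arg\min_{\alpha\in\mathbb{R}} f(y_k+\alpha v_k)$; set $x_k=y_k+\alpha_k v_k$. (The output is that of any run in which each line-search minimizer $\alpha_k$ exists.) *)

(* Defs.v *)
From HB Require Import structures.
From mathcomp Require Import all_boot all_order all_algebra.
From mathcomp Require Import all_classical all_reals all_analysis.

Set Implicit Arguments.
Unset Strict Implicit.
Unset Printing Implicit Defensive.

Import Order.TTheory GRing.Theory Num.Theory.

Local Open Scope classical_set_scope.
Local Open Scope ring_scope.

Definition dotv {R : realType} {d : nat} (u v : 'rV[R]_d) : R :=
  \sum_(i < d) u ord0 i * v ord0 i.

(* The library norm `|u| on row vectors is the sup norm, hence this one. *)
Definition norm2 {R : realType} {d : nat} (u : 'rV[R]_d) : R :=
  Num.sqrt (dotv u u).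

Definition argmin {R : realType} {T : Type} (f : T -> R) : set T :=
  [set x | forall y, f x <= f y].

(* A minimum as soon as argmin f is nonempty, see min_valueE. *)
Definition min_value {R : realType} {T : Type} (f : T -> R) : R :=
  inf (range f).

Lemma min_valueE {R : realType} {T : Type} (f : T -> R) (x : T) :
  argmin f x -> min_value f = f x.
Proof.
move=> fx; apply/eqP; rewrite eq_le; apply/andP; split.
  apply: ge_inf; last by exists x.
  by exists (f x) => _ [y _ <-]; exact: fx.
apply: lb_le_inf; first by exists (f x), x.
by move=> _ [y _ <-]; exact: fx.
Qed.

(* For nonempty closed A, in particular for A the set of minimizers of a
   convex function R^d -> R that has one, this infimum is attained. *)
Definition dist2 {R : realType} {d : nat} (x : 'rV[R]_d)
    (A : set 'rV[R]_d) : R :=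
  inf [set norm2 (x - a) | a in A].

Definition QG_upper {R : realType} {d : nat} (L : R)
    (f : 'rV[R]_d -> R) : Prop :=
  forall x, f x - min_value f <= L / 2 * dist2 x (argmin f) ^+ 2.

Definition subdifferential {R : realType} {d : nat} (f : 'rV[R]_d -> R)
    (x : 'rV[R]_d) : set 'rV[R]_d :=
  [set g | forall y, f x + dotv g (y - x) <= f y].

(* In both methods below, the clause for k < n describes iteration k + 1. *)

Definition heavy_ball_output {R : realType} {d : nat} (f : 'rV[R]_d -> R)
    (L : R) (x0 : 'rV[R]_d) (n : nat) (xn : 'rV[R]_d) : Prop :=
  exists x g : nat -> 'rV[R]_d,
    [/\ x 0%N = x0,
        forall k, (k < n)%N ->
          subdifferential f (x k) (g k) /\
          x k.+1 = (k.+1%:R / k.+2%:R) *: x k + k.+2%:R^-1 *: x0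
                   - k.+2%:R^-1 *: \sum_(i < k.+1) L^-1 *: g i
      & x n = xn].

Definition heavy_ball_line_search_output {R : realType} {d : nat}
    (f : 'rV[R]_d -> R) (x0 : 'rV[R]_d) (n : nat) (xn : 'rV[R]_d) : Prop :=
  exists (x y g v : nat -> 'rV[R]_d) (alpha : nat -> R),
    [/\ x 0%N = x0,
        v 0%N = 0,
        forall k, (k < n)%N ->
          [/\ y k.+1 = (k.+1%:R / k.+2%:R) *: x k + k.+2%:R^-1 *: x0,
              subdifferential f (x k) (g k) /\ dotv (g k) (v k) = 0,
              v k.+1 = v k + g k,
              argmin (fun a : R => f (y k.+1 + a *: v k.+1)) (alpha k.+1)
            & x k.+1 = y k.+1 + alpha k.+1 *: v k.+1]
      & x n = xn].

(* Main.v *)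
Require Import Defs.
From mathcomp Require Import all_boot all_order all_algebra.
From mathcomp Require Import all_classical all_reals all_analysis.
From mathcomp Require Import ring lra.
Import Order.TTheory GRing.Theory Num.Theory.
Local Open Scope classical_set_scope.
Local Open Scope ring_scope.

(** Write [S k] for the sum of the first [k] subgradients, and let [a] be a
    minimizer. Evaluating the subgradient inequality at [a + g / L] and using
    QG+ there gives [f x - f a <= <g, x - a> - |g|^2 / (2 L)]. Adding it to
    [k] times the subgradient inequality between consecutive iterates, the sum
    telescopes to
    [(k + 1) (f (x k) - f a) <= <S (k+1), x 0 - a> - |S (k+1)|^2 / (2 L)].
    No subgradient is available at the last iterate; but [f (x (k+1))] is at
    most the value of [f] at the convex combination of [x k] and
    [w = x 0 - S (k+1) / L], and QG+ at [w] bounds [f w - f a] by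
    [L/2 |x 0 - a|^2] minus the right-hand side above. *)

Section DotProduct.
Context {R : realType} {d : nat}.
Implicit Types (u v w : 'rV[R]_d) (c : R).

Lemma dotvC u v : dotv u v = dotv v u.
Proof. by apply: eq_bigr => i _; rewrite mulrC. Qed.

Lemma dotvDl u v w : dotv (u + v) w = dotv u w + dotv v w.
Proof. by rewrite -big_split; apply: eq_bigr => i _; rewrite mxE mulrDl. Qed.

Lemma dotvZl c u v : dotv (c *: u) v = c * dotv u v.
Proof. by rewrite mulr_sumr; apply: eq_bigr => i _; rewrite mxE mulrA. Qed.

Lemma dotvNl u v : dotv (- u) v = - dotv u v.
Proof. by rewrite -scaleN1r dotvZl mulN1r. Qed.

Lemma dotvDr u v w : dotv w (u + v) = dotv w u + dotv w v.
Proof. by rewrite !(dotvC w) dotvDl. Qed.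

Lemma dotvZr c u v : dotv v (c *: u) = c * dotv v u.
Proof. by rewrite !(dotvC v) dotvZl. Qed.

Lemma dotvNr u v : dotv v (- u) = - dotv v u.
Proof. by rewrite !(dotvC v) dotvNl. Qed.

Definition dotvE := (dotvDl, dotvDr, dotvNl, dotvNr, dotvZl, dotvZr).

Lemma norm2_ge0 u : 0 <= norm2 u.
Proof. exact: sqrtr_ge0. Qed.

Lemma sqr_norm2 u : norm2 u ^+ 2 = dotv u u.
Proof. by rewrite sqr_sqrtr// sumr_ge0// => i _; rewrite -expr2 sqr_ge0. Qed.

Lemma dist2_le (A : set 'rV[R]_d) u v : A v -> dist2 u A <= norm2 (u - v).
Proof.
move=> Av; apply: ge_inf; last by exists v.
by exists 0 => _ [w _ <-]; exact: norm2_ge0.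
Qed.

Lemma dist2_ge (A : set 'rV[R]_d) u c : A !=set0 ->
  (forall v, A v -> c <= norm2 (u - v)) -> c <= dist2 u A.
Proof.
move=> [v Av] le_c; apply: lb_le_inf; first by exists (norm2 (u - v)), v.
by move=> _ [w Aw <-]; exact: le_c.
Qed.

Lemma dist2_ge0 (A : set 'rV[R]_d) u : A !=set0 -> 0 <= dist2 u A.
Proof. by move=> A0; apply: dist2_ge => // v _; exact: norm2_ge0. Qed.

(** Turns bounds that hold for each minimizer into one on the squared distance, without knowing that
    the infimum is attained. A negative [c] is trivial; otherwise compare square roots. *)
Lemma sqr_dist2_ge (A : set 'rV[R]_d) u c : A !=set0 ->
  (forall v, A v -> c <= norm2 (u - v) ^+ 2) -> c <= dist2 u A ^+ 2.
Proof.
move=> A0 le_c; have [c_lt0|c_ge0] := ltP c 0.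
  by rewrite (le_trans (ltW c_lt0))// sqr_ge0.
rewrite -(sqr_sqrtr c_ge0) lerXn2r ?nnegrE ?sqrtr_ge0 ?dist2_ge0//.
apply: dist2_ge => // v /le_c.
by rewrite -(ler_sqrt _ (sqr_ge0 _)) sqrtr_sqr ger0_norm ?norm2_ge0.
Qed.

End DotProduct.

Lemma convex_functionP {R : realType} {d : nat} (f : 'rV[R]_d -> R)
    (u v : 'rV[R]_d) (t : R) :
  convex_function [set: convex_lmodType 'rV[R]_d] f -> 0 <= t <= 1 ->
  f (t *: u + (1 - t) *: v) <= t * f u + (1 - t) * f v.
Proof.
move=> f_convex /andP[t0 t1].
have := f_convex (Itv01 t0 t1) u v; rewrite convRE/=.
by apply; rewrite in_setT.
Qed.

Lemma natr_scale_average {R : numFieldType} {V : lmodType R} (k : nat)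
    (u v : V) :
  k.+2%:R *: ((k.+1%:R / k.+2%:R) *: u + k.+2%:R^-1 *: v) = k.+1%:R *: u + v.
Proof.
by rewrite scalerDr !scalerA mulrCA divff ?pnatr_eq0// mulr1 scale1r.
Qed.

Section HeavyBall.
Context {R : realType} {d : nat} (L : R) (f : 'rV[R]_d -> R) (a : 'rV[R]_d).
Hypotheses (L_gt0 : 0 < L) (a_min : argmin f a) (f_QG : QG_upper L f).

Lemma QG_upper_argmin u : f u - f a <= L / 2 * dotv (u - a) (u - a).
Proof.
rewrite -(min_valueE a_min) (le_trans (f_QG u))// ler_wpM2l//.
  by rewrite divr_ge0 ?ltW.
rewrite -sqr_norm2 lerXn2r ?nnegrE ?norm2_ge0 ?dist2_le//.
by apply: dist2_ge0; exists a.
Qed.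

Lemma subdifferential_gap u g : subdifferential f u g ->
  f u - f a <= dotv g (u - a) - L^-1 / 2 * dotv g g.
Proof.
(* This point minimizes [L / 2 * |z - a|^2 - <g, z - a>] over [z], so it gives the strongest
   bound. *)
move=> /(_ (a + L^-1 *: g)); have := QG_upper_argmin (a + L^-1 *: g).
have -> : a + L^-1 *: g - a = L^-1 *: g by rewrite addrC addKr.
have -> : L / 2 * dotv (L^-1 *: g) (L^-1 *: g) = L^-1 / 2 * dotv g g.
  by rewrite !dotvE; field; rewrite gt_eqF.
rewrite !dotvE; lra.
Qed.

(** [S] is left abstract so that it can be either an explicit sum of subgradients or the line-search
    direction [v]. *)
Variables (n : nat) (x g S : nat -> 'rV[R]_d).
Hypotheses (S0 : S 0 = 0) (SS : forall k, (k < n)%N -> S k.+1 = S k + g k)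
  (gP : forall k, (k < n)%N -> subdifferential f (x k) (g k)).
(* Holds for both methods: in the line search, because [g] is orthogonal
   to [S]. *)
Hypothesis stepP : forall k, (k.+1 < n)%N ->
  dotv (g k.+1) (k.+2%:R *: x k.+1 - k.+1%:R *: x k) =
  dotv (g k.+1) (x 0%N - L^-1 *: S k.+1).

Lemma heavy_ball_potential k : (k < n)%N ->
  k.+1%:R * (f (x k) - f a) <=
  dotv (S k.+1) (x 0%N - a) - L^-1 / 2 * dotv (S k.+1) (S k.+1).
Proof.
elim: k => [|k IHk] kn.
  by rewrite SS// S0 add0r mul1r; exact/subdifferential_gap/gP.
(* The term [- L^-1 * <g, S>] supplied by [stepP] is the cross term in the expansion of
   [- |S + g|^2 / (2 L)]. *)
have := IHk (ltnW kn); have := stepP _ kn.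
have := subdifferential_gap _ _ (gP _ kn).
have := ler_wpM2l (ler0n R k.+1) (gP _ kn (x k)).
rewrite (SS _ kn) !dotvE (dotvC (S k.+1) (g k.+1)) -[k.+2%:R]natr1.
lra.
Qed.

Hypothesis f_convex : convex_function [set: convex_lmodType 'rV[R]_d] f.
(** An equality of points for the fixed-step method; for the line search, the point on the right
    lies on the searched line. *)
Hypothesis lastP : forall k, n = k.+1 ->
  f (x n) <= f ((k.+1%:R / k.+2%:R) *: x k
                + k.+2%:R^-1 *: (x 0%N - L^-1 *: S k.+1)).

Lemma heavy_ball_rate :
  n.+1%:R * (f (x n) - f a) <= L / 2 * dotv (x 0%N - a) (x 0%N - a).
Proof.
case: n lastP heavy_ball_potential => [_ _|k last pot].
  (* With no iteration, the rate is QG+ at the starting point. *)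
  by rewrite mul1r QG_upper_argmin.
have {pot} := pot k (ltnSn k); have {last} := last k erefl.
set w := x 0%N - L^-1 *: S k.+1.
set t : R := k.+1%:R / k.+2%:R.
have t01 : 0 <= t <= 1.
  by rewrite divr_ge0// ler_pdivrMr// mul1r ler_nat leqnSn.
have tk : k.+2%:R * t = k.+1%:R by rewrite mulrC divfK// pnatr_eq0.
have tE : k.+2%:R^-1 = 1 - t.
  apply: (@mulfI _ k.+2%:R); first by rewrite pnatr_eq0.
  by rewrite divff ?pnatr_eq0// mulrBr mulr1 tk -[k.+2%:R]natr1 addrC addKr.
clearbody t.
have := convex_functionP f (x k) w t f_convex t01.
rewrite tE => fw /le_trans/(_ fw){fw}.
(* Clearing the denominator leaves weight [k + 1] on [f (x k)], as in the potential, and weight 1 on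
   [f w]. *)
rewrite -(ler_pM2l (ltr0Sn R k.+1)) mulrDr !mulrA mulrBr mulr1 tk.
have := QG_upper_argmin w.
have -> : L / 2 * dotv (w - a) (w - a) = L / 2 * dotv (x 0%N - a) (x 0%N - a)
    - dotv (S k.+1) (x 0%N - a) + L^-1 / 2 * dotv (S k.+1) (S k.+1).
  rewrite /w !dotvE (dotvC (x 0%N) (S k.+1)) (dotvC a (S k.+1)).
  by rewrite (dotvC (x 0%N) a); field; rewrite gt_eqF.
rewrite -[k.+2%:R]natr1; lra.
Qed.

End HeavyBall.

Theorem corollary2p5 (R : realType) (L : R) (n d : nat) (f : 'rV[R]_d -> R)
    (x0 xn : 'rV[R]_d)
    (L_gt0 : 0 < L)
    (f_min : argmin f !=set0)
    (f_convex : convex_function [set: convex_lmodType 'rV[R]_d] f)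
    (f_QG : QG_upper L f)
    (xn_output : heavy_ball_output f L x0 n xn \/
                 heavy_ball_line_search_output f x0 n xn) :
  f xn - min_value f <= L / 2 * (1 / n.+1%:R) * dist2 x0 (argmin f) ^+ 2.
Proof.
suff rate a : argmin f a ->
    n.+1%:R * (f xn - f a) <= L / 2 * dotv (x0 - a) (x0 - a).
  have c_gt0 : 0 < L / 2 * (1 / n.+1%:R) by rewrite mulr_gt0 ?divr_gt0.
  rewrite -ler_pdivrMl//; apply: sqr_dist2_ge => // a amin.
  rewrite ler_pdivrMl// sqr_norm2 (min_valueE amin) div1r mulrAC.
  by rewrite ler_pdivlMr// mulrC rate.
move=> amin; case: xn_output => [[x [g [<- it <-]]]|].
  pose S k := \sum_(i < k) g i.
  have S0 : S 0%N = 0 by rewrite /S big_ord0.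
  have SS k : (k < n)%N -> S k.+1 = S k + g k by rewrite /S big_ord_recr.
  (* Regrouped as an average of [x k] and [x 0 - S / L], the update yields both the step identity
     and the last-iterate bound. *)
  have xE k : (k < n)%N -> x k.+1 = (k.+1%:R / k.+2%:R) *: x k
      + k.+2%:R^-1 *: (x 0%N - L^-1 *: S k.+1).
    by move=> /it[_ ->]; rewrite -scaler_sumr scalerBr addrA.
  apply: (@heavy_ball_rate _ _ L f a L_gt0 amin f_QG n x g S) => //.
  - by move=> k /it[].
  - by move=> k /ltnW/xE ->; rewrite natr_scale_average addrC addKr.
  - by move=> k nk; rewrite nk -xE ?nk.
move=> [x [y [g [v [alpha [<- v0 it <-]]]]]].
apply: (@heavy_ball_rate _ _ L f a L_gt0 amin f_QG n x g v) => //.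
- by move=> k /it[].
- by move=> k /it[_ []].
- move=> k kn; have [yE _ _ _ xE] := it k (ltnW kn).
  have [_ [_ gv] _ _ _] := it _ kn.
  (* What remains is [x 0] plus a multiple of [v]; orthogonality removes the [v] terms on both
     sides. *)
  rewrite xE yE scalerDr natr_scale_average addrAC [X in X + _]addrC addKr.
  by rewrite !dotvE gv !mulr0 oppr0.
- move=> k nk; have [yE _ _ amin' xE] := it k ltac:(by rewrite nk).
  (* This trial step size reproduces the fixed-step update from the same [x k] and [v]. *)
  rewrite nk xE (le_trans (amin' (- (k.+2%:R^-1 * L^-1))))// yE.
  by rewrite scalerBr addrA scaleNr scalerA.
Qed.
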